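(* For any $N\in\mathbb{N}$, any $X=\{x_1<x_2<\dots<x_N\}\subset(0,1)$ and any $\varepsilon>0$, with $x_0:=0$, $x_{N+1}:=1$, $h_i:=x_{i+1}-x_i$ for $0\le i\le N$, and $h_X:=\frac12\max_{0\le i\le N}h_i$, we have $$\|P_{1,\varepsilon,X}\|_{L_\infty(0,1)}=\max_{0\le i\le N}\sqrt{\frac{\tanh(\varepsilon h_i/2)}{2\varepsilon}}=\sqrt{\frac{\tanh(\varepsilon h_X)}{2\varepsilon}}=\frac{1}{\sqrt2}\,h_X^{1/2}+\mathcal{O}(\varepsilon h_X^{3/2}),$$ where the $\mathcal{O}$ term contains exact orders in terms of both $\varepsilon$ and $h_X$. In particular, for each $N\in\mathbb{N}$ the set $\overline X:=\{x_i:=i/(N+1)\}_{i=1}^N$ of equally spaced points is the unique minimizer of $\|P_{1,\varepsilon,X}\|_{L_\infty(0,1)}$ (among sets $X\subset(0,1)$ of $N$ points), with value $$\|P_{1,\varepsilon,\overline X}\|_{L_\infty(0,1)}=\sqrt{\frac{\tanh\!\left(\varepsilon/(2(N+1))\right)}{2\varepsilon}}=\frac12(N+1)^{-1/2}+\mathcal{O}\!\left(\varepsilon(N+1)^{-3/2}\right).$$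
   Context: For $\varepsilon>0$ the Brownian Bridge kernel $k_{1,\varepsilon}:(0,1)^2\to\mathbb{R}$ is $$k_{1,\varepsilon}(x,y)=\frac{\sinh(\varepsilon\min(x,y))\,\sinh(\varepsilon(1-\max(x,y)))}{\varepsilon\sinh(\varepsilon)},\quad x,y\in(0,1).$$ It is strictly positive definite on $(0,1)$. The cardinal (Lagrange) basis of $V_{1,\varepsilon}(X)=\operatorname{span}\{k_{1,\varepsilon}(\cdot,x):x\in X\}$ is the family of unique elements $\ell_{1,\varepsilon,i}\in V_{1,\varepsilon}(X)$, $1\le i\le N$, with $\ell_{1,\varepsilon,i}(x_j)=\delta_{ij}$ for $1\le i,j\le N$. The power function $P_{1,\varepsilon,X}:(0,1)\to[0,\infty)$ is defined by $$P_{1,\varepsilon,X}(x)^2:=k_{1,\varepsilon}(x,x)-\sum_{i=1}^N\ell_{1,\varepsilon,i}(x)\,k_{1,\varepsilon}(x,x_i),\quad x\in(0,1).$$ The quantity $h_X$ is the fill distance including the boundary points: $h_X=\max_{x\in(0,1)}\min_{0\le i\le N+1}|x-x_i|=\frac12\max_{0\le i\le N}h_i$. *)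

(* Defs.v *)
From HB Require Import structures.
From mathcomp Require Import all_boot all_order all_algebra.
From mathcomp Require Import all_classical all_reals all_analysis.

Set Implicit Arguments.
Unset Strict Implicit.
Unset Printing Implicit Defensive.
Import Order.TTheory GRing.Theory Num.Theory.
Import numFieldNormedType.Exports.

Local Open Scope classical_set_scope.
Local Open Scope ring_scope.

Definition sinh {R : realType} (t : R) : R := (expR t - expR (- t)) / 2.
Definition cosh {R : realType} (t : R) : R := (expR t + expR (- t)) / 2.
Definition tanh {R : realType} (t : R) : R := sinh t / cosh t.

Definition bb_kernel {R : realType} (eps x y : R) : R :=
  sinh (eps * Num.min x y) * sinh (eps * (1 - Num.max x y))
  / (eps * sinh eps).

(* A set of N points of (0,1) is represented by its increasing enumeration,
   so that equality of tuples is equality of point sets; [tnth x i] is the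
   point with 1-based index [i.+1]. *)
Definition point_set {R : realType} (N : nat) (x : N.-tuple R) : Prop :=
  sorted <%R x /\ all (fun t => 0 < t < 1) x.

(* Points including the boundary: index 0 gives 0, index N.+1 gives 1. *)
Definition node {R : realType} (N : nat) (x : N.-tuple R) (i : nat) : R :=
  nth 0 (0 :: rcons x 1) i.

Definition gap {R : realType} (N : nat) (x : N.-tuple R) (i : 'I_N.+1) : R :=
  node x i.+1 - node x i.

(* The gaps of a point set are positive, so 0 is neutral for the maximum. *)
Definition fill_distance {R : realType} (N : nat) (x : N.-tuple R) : R :=
  2^-1 * \big[Num.max/0]_(i < N.+1) gap x i.

(* Functions on (0,1) are represented by functions on R, of which only the
   values on (0,1) are used. *)
Definition kernel_span {R : realType} (eps : R) (N : nat) (x : N.-tuple R) :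
    set (R -> R) :=
  [set fun y => \sum_(j < N) c j * bb_kernel eps y (tnth x j)
    | c in [set: 'I_N -> R]].

Definition is_cardinal_basis {R : realType} (eps : R) (N : nat)
    (x : N.-tuple R) (l : 'I_N -> R -> R) : Prop :=
  (forall i, kernel_span eps x (l i)) /\
  (forall i j, l i (tnth x j) = (i == j)%:R).

(* The kernel is strictly positive definite on (0,1), so for 0 < eps and a
   point set x exactly one family satisfies [is_cardinal_basis]; the default
   value of [xget] is then irrelevant. *)
Definition cardinal_basis {R : realType} (eps : R) (N : nat)
    (x : N.-tuple R) : 'I_N -> R -> R :=
  xget (fun _ _ => 0) (is_cardinal_basis eps x).

Definition power_function {R : realType} (eps : R) (N : nat)
    (x : N.-tuple R) (y : R) : R :=
  Num.sqrt (bb_kernel eps y y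
    - \sum_(i < N) cardinal_basis eps x i y * bb_kernel eps y (tnth x i)).

Definition lebesgue01 (R : realType) :
    {measure set (measurableTypeR R) -> \bar R} :=
  mrestr lebesgue_measure
    (measurable_itv `]0, 1[ : measurable (`]0, 1[ : set (measurableTypeR R))).

Definition Linf_norm01 {R : realType} (f : R -> R) : \bar R :=
  'N[lebesgue01 R]_+oo%E[EFin \o f]%E.

Definition power_norm {R : realType} (eps : R) (N : nat) (x : N.-tuple R) :
    \bar R :=
  Linf_norm01 (power_function eps x).

Definition equispaced {R : realType} (N : nat) : N.-tuple R :=
  [tuple i.+1%:R / N.+1%:R | i < N].

(* Main.v *)
(* The kernel is the Green function of -u'' + e^2 u with Dirichlet conditions.
   Hence for y between consecutive nodes p < q, the section K(y, .) coincides
   on all nodes with a K(p, .) + b K(q, .), where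
   a = sinh(e(q - y)) / sinh(e(q - p)) and b = sinh(e(y - p)) / sinh(e(q - p)),
   so the cardinal functions at y are a and b at the two neighbouring nodes and
   0 elsewhere. This gives, on that gap,
     P(y)^2 = sinh(e(y - p)) sinh(e(q - y)) / (e sinh(e(q - p))),
   which is maximal at the midpoint, with value tanh(e(q - p)/2) / (2e).
   As tanh increases, the norm is governed by the largest gap, and the gaps sum
   to 1. The asymptotics follow from |tanh t - t| <= 2 t^2 for t >= 0. *)

Require Import Defs.
From HB Require Import structures.
From mathcomp Require Import all_boot all_order all_algebra.
From mathcomp Require Import all_classical all_reals all_analysis.
From mathcomp Require Import ess_sup_inf ring lra.

Set Implicit Arguments.
Unset Strict Implicit.
Unset Printing Implicit Defensive.
Import Order.TTheory GRing.Theory Num.Theory.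
Import numFieldNormedType.Exports.

Local Open Scope classical_set_scope.
Local Open Scope ring_scope.

(** * Hyperbolic identities and estimates *)

Section hyperbolic.
Context {R : realType}.
Implicit Types a b c s t : R.

Lemma sinh0 : sinh (0 : R) = 0.
Proof. by rewrite /sinh oppr0 subrr mul0r. Qed.

Lemma cosh_gt0 t : 0 < cosh t.
Proof. by rewrite /cosh divr_gt0// addr_gt0// expR_gt0. Qed.

Lemma sinh_gt0 t : 0 < t -> 0 < sinh t.
Proof.
by move=> t0; rewrite /sinh divr_gt0// subr_gt0 ltr_expR; lra.
Qed.

Lemma sinh_ge0 t : 0 <= t -> 0 <= sinh t.
Proof.
by rewrite le_eqVlt => /predU1P[<-|/sinh_gt0/ltW//]; rewrite sinh0.
Qed.

Lemma continuous_sinh : continuous (@sinh R).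
Proof.
move=> t; apply: cvgM; last exact: cvg_cst.
apply: cvgB; first exact: continuous_expR.
apply: (@continuous_comp _ _ _ (fun u : R => - u) expR).
  exact: opp_continuous.
exact: continuous_expR.
Qed.

(** As a function of [c] the left side solves u'' = u and vanishes at [a] and [b]. All the
    three-term relations of the kernel come from this identity. *)
Lemma sinh_three_term a b c :
  sinh (c - b) * sinh a - sinh (c - a) * sinh b + sinh (b - a) * sinh c = 0.
Proof.
rewrite /sinh !opprB !expRD !expRN.
field.
by rewrite !gt_eqF ?expR_gt0.
Qed.

(** For a fixed sum [s + t] this shows the product to be largest at [s = t], which locates the
    maximum of the power function on a gap. *)
Lemma sinhM_midpoint s t :
  sinh s * sinh t = sinh ((s + t) / 2) ^+ 2 - sinh ((s - t) / 2) ^+ 2.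
Proof.
have -> : s = s / 2 + s / 2 by lra.
have -> : t = t / 2 + t / 2 by lra.
set u := s / 2; set v := t / 2.
have -> : (u + u + (v + v)) / 2 = u + v by lra.
have -> : (u + u - (v + v)) / 2 = u - v by lra.
rewrite /sinh !opprB !opprD !expRD !expRN.
field.
by rewrite !gt_eqF ?expR_gt0.
Qed.

Lemma tanh_half t : 0 < t -> sinh (t / 2) ^+ 2 / sinh t = tanh (t / 2) / 2.
Proof.
move=> t0; have -> : sinh t = 2 * sinh (t / 2) * cosh (t / 2).
  have {1}-> : t = t / 2 + t / 2 by lra.
  rewrite /sinh /cosh !opprD !expRD !expRN; field.
  by rewrite !gt_eqF ?expR_gt0.
rewrite /tanh; field.
by rewrite !gt_eqF ?cosh_gt0 ?sinh_gt0//; lra.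
Qed.

(** With a single exponential left, monotonicity and bounds of [tanh] reduce to those of [expR]. *)
Lemma tanhE t : tanh t = 1 - 2 / (expR (2 * t) + 1).
Proof.
have -> : 2 * t = t + t by lra.
have e0 := expR_gt0 t.
rewrite /tanh /sinh /cosh expRD expRN; field.
by rewrite !gt_eqF// addr_gt0// mulr_gt0.
Qed.

Lemma ler_tanh : {mono (@tanh R) : s t / s <= t}.
Proof.
apply: le_mono => s t st; rewrite !tanhE ltrD2l ltrN2 ltr_pM2l//.
by rewrite ltf_pV2 ?posrE ?addr_gt0 ?expR_gt0// ltrD2r ltr_expR ltr_pM2l.
Qed.

Lemma tanh_ge0 t : 0 <= t -> 0 <= tanh t.
Proof. by move=> t0; rewrite /tanh divr_ge0 ?sinh_ge0// ltW// cosh_gt0. Qed.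

Lemma tanh_sub_id t : 0 <= t -> `|tanh t - t| <= 2 * t ^+ 2.
Proof.
move=> t0; rewrite tanhE.
set E := expR (2 * t).
have E1 : 1 + 2 * t <= E by exact: expR_ge1Dx.
have F1 : 1 - 2 * t <= E^-1 by rewrite /E -expRN; exact: expR_ge1Dx.
have E0 : 0 < E by exact: expR_gt0.
have E2 : E * (1 - 2 * t) <= 1 by rewrite -[leRHS](mulfV (lt0r_neq0 E0)) ler_pM2l.
set V := 2 / (E + 1).
have V0 : 0 < V by rewrite divr_gt0// addr_gt0.
have VE : V * (E + 1) = 2 by rewrite divfK// gt_eqF// addr_gt0.
clearbody V E; rewrite ler_norml; apply/andP; split.
  (* [E >= 1 + 2 t] gives [V <= 1 / (1 + t)], that is, tanh t >= t / (1 + t); hence the factor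
     [2 * (1 + t)]. *)
  rewrite -subr_ge0 -(pmulr_lge0 _ (_ : 0 < 2 * (1 + t))); last by lra.
  have := ler_wpM2l (ltW V0) E1; have := mulr_ge0 (sqr_ge0 t) t0.
  by move=> ? ?; nra.
(* For [t >= 1 / 2] it is enough that tanh t < 1. Below that, [E2] gives tanh t <= t / (1 - t) = t +
   t^2 / (1 - t) <= t + 2 t^2. *)
have [t2|t2] := lerP (1 / 2) t; first by nra.
rewrite -subr_ge0 -(pmulr_lge0 _ (_ : 0 < 2 * (1 - t))); last by lra.
have := ler_wpM2l (ltW V0) E2; have := mulr_ge0 (sqr_ge0 t) (_ : 0 <= 1 - 2 * t).
by move=> /(_ ltac:(lra)) ? ?; nra.
Qed.

(** Write [A] for the first root and [B] for sqrt (h / 2). Then |A - B| B <= |A^2 - B^2| <= e h^2 by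
    [tanh_sub_id], and division by [B] gives the power 3/2. The case [h = 0], where [B] vanishes, is
    separate. *)
Lemma sqrt_tanh_sub (e h : R) : 0 < e -> 0 <= h ->
  `|Num.sqrt (tanh (e * h) / (2 * e)) - (Num.sqrt 2)^-1 * h `^ (1 / 2)|
    <= 2 * (e * h `^ (3 / 2)).
Proof.
move=> e0; rewrite le_eqVlt => /predU1P[<-|h0].
  rewrite mulr0 /tanh sinh0 !mul0r sqrtr0 !powR0 ?mulr0 ?subr0 ?normr0 ?mulr0//.
have -> : h `^ (1 / 2) = Num.sqrt h by rewrite div1r powR12_sqrt ?ltW.
have -> : h `^ (3 / 2) = h * Num.sqrt h.
  have -> : 3 / 2 = 1 + 2^-1 :> R by lra.
  by rewrite powRD ?gt_eqF ?implybT// powRr1 ?ltW// powR12_sqrt ?ltW.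
have eh0 : 0 <= e * h by rewrite mulr_ge0 ?ltW.
set A := Num.sqrt (_ / _).
have A0 : 0 <= A by exact: sqrtr_ge0.
have e20 : 0 < 2 * e by rewrite mulr_gt0.
have A2 : A ^+ 2 * (2 * e) = tanh (e * h).
  rewrite sqr_sqrtr ?divfK ?gt_eqF//.
  by apply: divr_ge0; [exact: tanh_ge0 | exact: ltW].
set r2 := Num.sqrt (2 : R); set s := Num.sqrt h.
have r20 : 0 < r2 by rewrite sqrtr_gt0.
have r22 : r2 ^+ 2 = 2 by rewrite sqr_sqrtr.
have s0 : 0 < s by rewrite sqrtr_gt0.
have s2 : s ^+ 2 = h by rewrite sqr_sqrtr ?ltW.
set B := r2^-1 * s.
have B0 : 0 < B by rewrite mulr_gt0 ?invr_gt0.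
have Br : B * r2 = s by rewrite /B mulrAC mulVf ?gt_eqF// mul1r.
have B2 : B ^+ 2 * 2 = h by rewrite -s2 -Br [RHS]exprMn r22.
have key : `|A - B| * B <= e * h ^+ 2.
  apply: (@le_trans _ _ (`|A - B| * (A + B))).
    by rewrite ler_wpM2l// lerDr.
  rewrite -[X in _ * X]ger0_norm ?addr_ge0 ?(ltW B0)// -normrM -subr_sqr.
  rewrite -(ler_pM2r e20).
  rewrite -[X in `|_| * X](gtr0_norm e20) -normrM mulrBl A2 mulrA B2.
  rewrite (mulrC h).
  by apply: (le_trans (tanh_sub_id eh0)); rewrite exprMn; nra.
(* Division by [B] yields the constant sqrt 2, which is rounded up to 2. *)
have r2le : r2 <= 2 by nra.
rewrite -(ler_pM2r B0); apply: (le_trans key).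
have -> : 2 * (e * (h * s)) * B = e * (h ^+ 2) * (2 / r2).
  by rewrite /B -s2; field; rewrite gt_eqF.
by rewrite ler_peMr ?ler_pdivlMr ?mul1r// mulr_ge0 ?sqr_ge0// ltW.
Qed.

End hyperbolic.

(** * The essential supremum on (0,1) *)

Section sup_norm.
Context {R : realType}.

(** An essential supremum ignores null sets, so attaining [M] at a point would not suffice: each
    [c < M] must be exceeded on an interval, which has positive measure. *)
Lemma Linf_norm01_eq (f : R -> R) (M : R) :
  (forall y : R, 0 < y < 1 -> 0 <= f y <= M) ->
  (forall c, c < M -> exists a b : R, [/\ 0 <= a, a < b, b <= 1 &
     forall y : R, a < y < b -> c < f y]) ->
  Linf_norm01 f = M%:E.
Proof.
move=> fM Mf; rewrite /Linf_norm01 unlock /=.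
have mI (i : interval R) : measurable ([set` i] : set (measurableTypeR R)).
  exact: measurable_itv.
have muE (a b : R) : 0 <= a -> a < b -> b <= 1 ->
    lebesgue01 R `]a, b[%classic = (b - a)%:E.
  move=> a0 ab b1; rewrite /lebesgue01 /= /mrestr setIidl.
    by rewrite lebesgue_measure_itv/= lte_fin ab EFinB.
  move=> y /=; rewrite !in_itv/= => /andP[ay yb].
  by rewrite (le_lt_trans a0 ay) (lt_le_trans yb b1).
(* The norm with exponent infinity is defined by cases on whether the total mass is positive. *)
have muT : (0 < lebesgue01 R setT)%E.
  apply: (@lt_le_trans _ _ (lebesgue01 R `]0%R, 1%R[%classic)).
    by rewrite muE// subr0 lte01.
  by apply: le_measure => //; rewrite inE.
rewrite muT; apply/eqP; rewrite eq_le; apply/andP; split.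
  apply/ess_supP; exists (~` `]0, 1[%classic); split.
  - exact: measurableC.
  - by rewrite /lebesgue01 /= /mrestr setICl measure0.
  - move=> y /=; apply: contra_not; rewrite /= in_itv/= => /fM/andP[f0 fyM].
    by rewrite lee_fin ger0_norm.
rewrite leNgt; apply/negP => ltM.
have [c cM /ess_supP[N [mN N0 subN]]] : exists2 c, c < M &
    (ess_sup (lebesgue01 R) (abse \o (EFin \o f)) <= c%:E)%E.
  case: ess_sup ltM => [r|//|_].
    by rewrite lte_fin => rM; exists r.
  (* If the essential supremum were -oo, any real below [M] would bound it. *)
  by exists (M - 1); [rewrite ltrBlDr ltrDl | rewrite leNye].
have [a [b [a0 ab b1 cf]]] := Mf _ cM.
have : (lebesgue01 R `]a, b[%classic <= 0)%E.
  rewrite -N0; apply: le_measure; rewrite ?inE//.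
  move=> y /=; rewrite in_itv/= => /cf cfy; apply: subN => /=.
  by rewrite lee_fin => /(le_trans (ler_norm _)); rewrite leNgt cfy.
by rewrite muE// lee_fin subr_le0 leNgt ab.
Qed.

End sup_norm.

(** * Three-term relations and two-point interpolation of the kernel *)

Section kernel.
Context {R : realType}.
Variable e : R.
Hypothesis e0 : 0 < e.
Local Notation K := (bb_kernel e).

Lemma bb_kernelC y z : K y z = K z y.
Proof. by rewrite /bb_kernel minC maxC. Qed.

Lemma bb_kernel_le y z : y <= z ->
  K y z = sinh (e * y) * sinh (e * (1 - z)) / (e * sinh e).
Proof. by move=> yz; rewrite /bb_kernel min_l// max_r. Qed.

Lemma bb_kernelx0 y : 0 <= y -> K y 0 = 0.
Proof. by move=> y0; rewrite bb_kernelC bb_kernel_le// mulr0 sinh0 !mul0r. Qed.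

Lemma bb_kernelx1 y : y <= 1 -> K y 1 = 0.
Proof. by move=> y1; rewrite bb_kernel_le// subrr mulr0 sinh0 mulr0 mul0r. Qed.

(* As a function of [y] the combination solves u'' = e^2 u away from the kinks
   p, q, r; it is a bump supported on [p, r]. *)
Lemma bb_kernel_three_term_out p q r y : p <= q -> q <= r ->
  y <= p \/ r <= y ->
  sinh (e * (r - q)) * K y p - sinh (e * (r - p)) * K y q
    + sinh (e * (q - p)) * K y r = 0.
Proof.
move=> pq qr [yp|ry].
  have yq := le_trans yp pq; have yr := le_trans yq qr.
  rewrite !bb_kernel_le//.
  have := sinh_three_term (e * (1 - r)) (e * (1 - q)) (e * (1 - p)).
  have -> : e * (1 - p) - e * (1 - q) = e * (q - p) by ring.
  have -> : e * (1 - q) - e * (1 - r) = e * (r - q) by ring.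
  have -> : e * (1 - p) - e * (1 - r) = e * (r - p) by ring.
  move=> /(congr1 (fun t => t * (sinh (e * y) / (e * sinh e)))).
  by rewrite mul0r => <-; ring.
have qy := le_trans qr ry; have py := le_trans pq qy.
rewrite !(bb_kernelC y) !bb_kernel_le//.
have := sinh_three_term (e * p) (e * q) (e * r); rewrite -!mulrBr.
move=> /(congr1 (fun t => t * (sinh (e * (1 - y)) / (e * sinh e)))).
by rewrite mul0r => <-; ring.
Qed.

(** At the middle kink the bump is nonzero. Its height serves both to normalise the cardinal
    functions and to compute the interpolation error. *)
Lemma bb_kernel_three_term_mid p q r : p <= q -> q <= r ->
  sinh (e * (r - q)) * K q p - sinh (e * (r - p)) * K q q
    + sinh (e * (q - p)) * K q r
  = - (sinh (e * (q - p)) * sinh (e * (r - q)) / e).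
Proof.
move=> pq qr; rewrite (bb_kernelC q p) !bb_kernel_le//.
have := sinh_three_term (e * q) (e * r) (e * 1); rewrite -!mulrBr.
have := sinh_three_term (e * p) (e * q) (e * r); rewrite -!mulrBr mulr1.
have S0 : sinh e != 0 by rewrite gt_eqF// sinh_gt0.
have en0 : e != 0 by rewrite gt_eqF.
set a := sinh (e * (r - q)); set b := sinh (e * (q - p)).
set c := sinh (e * (r - p)); set f := sinh (e * (1 - q)).
set g := sinh (e * (1 - r)).
set s1 := sinh (e * p); set s2 := sinh (e * q); set s3 := sinh (e * r).
(* Adding and subtracting [f * b * s3] and [b * a * sinh e] exposes the two vanishing combinations
   [H1] and [H2]. *)
move=> H1 H2; apply: (@mulIf _ (e * sinh e)); first by rewrite mulf_neq0.
transitivity (f * (a * s1 - c * s2 + b * s3)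
   + b * (g * s2 - f * s3 + a * sinh e) - b * a * sinh e).
  by field; rewrite S0.
by rewrite H1 H2; field.
Qed.

(** This is the three-term relation with [y] as middle point, taken outside the bump and solved for
    the middle term. *)
Lemma bb_kernel_interp p q y z : p < q -> p <= y <= q -> z <= p \/ q <= z ->
  K y z = sinh (e * (q - y)) / sinh (e * (q - p)) * K p z
        + sinh (e * (y - p)) / sinh (e * (q - p)) * K q z.
Proof.
move=> pq /andP[py yq] zpq; have := bb_kernel_three_term_out py yq zpq.
rewrite !(bb_kernelC z) => H.
have S0 : sinh (e * (q - p)) != 0.
  by rewrite gt_eqF// sinh_gt0// mulr_gt0// subr_gt0.
apply: (mulfI S0); apply/eqP; rewrite -subr_eq0 -oppr_eq0 -H; apply/eqP.
by field.
Qed.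

(** The same relation at its middle point: the error is the height of the bump, up to sign and
    division by [sinh (e * (q - p))]. *)
Lemma bb_kernel_interp_error p q y : p < q -> p <= y <= q ->
  K y y - (sinh (e * (q - y)) / sinh (e * (q - p)) * K y p
        + sinh (e * (y - p)) / sinh (e * (q - p)) * K y q)
  = sinh (e * (y - p)) * sinh (e * (q - y)) / (e * sinh (e * (q - p))).
Proof.
move=> pq /andP[py yq]; have H := bb_kernel_three_term_mid py yq.
have S0 : sinh (e * (q - p)) != 0.
  by rewrite gt_eqF// sinh_gt0// mulr_gt0// subr_gt0.
have en0 : e != 0 by rewrite gt_eqF.
apply: (mulfI S0); apply: oppr_inj.
transitivity (- (sinh (e * (y - p)) * sinh (e * (q - y)) / e)).
  by rewrite -H; field.
by field; rewrite S0.
Qed.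

End kernel.

(** * Order of the nodes and location of a point in a gap *)

Section nodes.
Context {R : realType} {N : nat}.
Variable x : N.-tuple R.

Lemma node_last : node x N.+1 = 1.
Proof. by rewrite /node /= nth_rcons size_tuple ltnn eqxx. Qed.

Lemma node_tnth (j : 'I_N) : node x j.+1 = tnth x j.
Proof. by rewrite /node /= nth_rcons size_tuple ltn_ord -tnth_nth. Qed.

Lemma sum_gap : \sum_(i < N.+1) gap x i = 1.
Proof.
transitivity (\sum_(0 <= i < N.+1) (node x i.+1 - node x i)).
  by rewrite big_mkord.
by rewrite telescope_sumr// node_last subr0.
Qed.

Hypothesis hx : point_set x.

Lemma ltr_node i j : (i < j <= N.+1)%N -> node x i < node x j.
Proof.
case: hx => xs x01 /andP[ij jN].
have Hsorted : sorted <%R (0 :: rcons x 1).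
  rewrite /= rcons_path path_sortedE; last exact: lt_trans.
  rewrite xs andbT; apply/andP; split.
    by apply: sub_all x01 => t /andP[].
  have := mem_last 0 x; rewrite inE => /predU1P[->|]; first exact: ltr01.
  by move=> /(allP x01)/andP[].
rewrite /node lt_sorted_ltn_nth//.
  by rewrite inE /= size_rcons size_tuple ltnS (leq_trans (ltnW ij)).
by rewrite inE /= size_rcons size_tuple ltnS.
Qed.

Lemma ler_node i j : (i <= j <= N.+1)%N -> node x i <= node x j.
Proof.
move=> /andP[]; rewrite leq_eqVlt => /predU1P[->//|ij jN].
by rewrite ltW// ltr_node// ij.
Qed.

Lemma gap_gt0 i : 0 < gap x i.
Proof. by rewrite /gap subr_gt0 ltr_node// leqnn/=. Qed.

Lemma node01 i : (i <= N.+1)%N -> 0 <= node x i <= 1.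
Proof.
move=> iN; apply/andP; split; first by apply: (@ler_node 0); rewrite iN.
by rewrite -node_last ler_node// iN/=.
Qed.

Lemma gap_locate y : 0 < y < 1 ->
  exists i : 'I_N.+1, node x i <= y <= node x i.+1.
Proof.
move=> /andP[y0 y1].
have exP : exists m, y <= node x m by exists N.+1; rewrite node_last ltW.
(* The gap ends at the first node at or above [y]; index 0 is excluded by [0 < y]. *)
case: (ex_minnP exP) => -[|m] ym mmin; first by rewrite leNgt y0 in ym.
have mN : (m < N.+1)%N by rewrite mmin// node_last ltW.
exists (Ordinal mN); rewrite /= ym andbT leNgt; apply/negP => /ltW/mmin.
by rewrite ltnn.
Qed.

Lemma node_outside_gap (i : 'I_N.+1) (j : nat) : (j <= N.+1)%N ->
  node x j <= node x i \/ node x i.+1 <= node x j.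
Proof.
move=> jN; have [ji|ij] := leqP j i.
  by left; rewrite ler_node// ji ltnW// ltnW.
by right; rewrite ler_node// ij.
Qed.

End nodes.

(** * The cardinal basis and the power function on one gap *)

Section cardinal.
Context {R : realType} {N : nat}.
Variables (e : R) (x : N.-tuple R).
Hypotheses (e0 : 0 < e) (hx : point_set x).
Local Notation K := (bb_kernel e).

(* Summing over the interior points only is harmless: the kernel vanishes at
   the boundary nodes. *)
Lemma sum_kernel_node m y : (m <= N.+1)%N -> 0 <= y <= 1 ->
  \sum_(j < N) (j.+1 == m)%:R * K y (tnth x j) = K y (node x m).
Proof.
move=> mN /andP[y0 y1].
have zero : (forall j : 'I_N, j.+1 != m) -> K y (node x m) = 0 ->
    \sum_(j < N) (j.+1 == m)%:R * K y (tnth x j) = K y (node x m).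
  by move=> jm ->; rewrite big1// => j _; rewrite (negbTE (jm j)) mul0r.
case: m mN zero => [|m] mN zero; first by rewrite zero// bb_kernelx0.
move: mN; rewrite leq_eqVlt => /predU1P[[mN]|mN].
  rewrite zero//; last by rewrite mN node_last bb_kernelx1.
  by move=> j; rewrite mN eqSS ltn_eqF.
rewrite (bigD1 (Ordinal (mN : (m < N)%N)))//= eqxx mul1r big1 ?addr0.
  by rewrite -node_tnth.
by move=> j; rewrite -val_eqE/= eqSS => /negbTE->; rewrite mul0r.
Qed.

(* Column [i.+1] of the inverse of the kernel matrix, which is tridiagonal:
   [m] and [i.+1] are node indices, and the coefficients falling on the
   boundary nodes [0] and [N.+1] multiply a zero kernel. *)
Definition hat_coef (i : 'I_N) (m : nat) : R :=
  let p := node x i in let q := node x i.+1 in let r := node x i.+2 in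
  - e / (sinh (e * (q - p)) * sinh (e * (r - q))) *
  (sinh (e * (r - q)) * (m == i)%:R - sinh (e * (r - p)) * (m == i.+1)%:R
   + sinh (e * (q - p)) * (m == i.+2)%:R).

(** The bump on three consecutive nodes, scaled to height 1 at the middle one, vanishes at every
    other node. *)
Lemma exists_cardinal_basis : exists l, is_cardinal_basis e x l.
Proof.
exists (fun i y => \sum_(j < N) hat_coef i j.+1 * K y (tnth x j)); split.
  by move=> i; exists (fun j : 'I_N => hat_coef i j.+1).
move=> i k; set y := tnth x k.
have yk : y = node x k.+1 by rewrite node_tnth.
have y01 : 0 <= y <= 1 by rewrite yk node01// ltnS ltnW.
have iN := ltn_ord i.
have pq : node x i < node x i.+1 by rewrite ltr_node// leqnn ltnW.
have qr : node x i.+1 < node x i.+2 by rewrite ltr_node// leqnn ltnS.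
have iN2 : (i.+2 <= N.+1)%N by [].
have iN1 := ltnW iN2; have iN0 := ltnW iN1.
rewrite /hat_coef -!/(node x i).
set p := node x i; set q := node x i.+1; set r := node x i.+2.
set c := - e / _.
transitivity (c * (sinh (e * (r - q)) * K y p - sinh (e * (r - p)) * K y q
                   + sinh (e * (q - p)) * K y r)).
  rewrite /p /q /r -!sum_kernel_node// !mulr_sumr -sumrB -big_split mulr_sumr/=.
  by apply: eq_bigr => j _; ring.
have Sqp : sinh (e * (q - p)) != 0.
  by rewrite gt_eqF// sinh_gt0// mulr_gt0// subr_gt0.
have Srq : sinh (e * (r - q)) != 0.
  by rewrite gt_eqF// sinh_gt0// mulr_gt0// subr_gt0.
have [ik|ik] := eqVneq i k.
  have -> : y = q by rewrite yk /q ik.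
  rewrite bb_kernel_three_term_mid ?ltW// /c /=; field.
  by rewrite Sqp Srq gt_eqF.
rewrite bb_kernel_three_term_out ?mulr0 ?(ltW pq) ?(ltW qr)// yk.
move: ik; rewrite -val_eqE neq_ltn => /orP[ik|ki].
  by right; rewrite /r ler_node// !ltnS ik/= ltnW.
by left; rewrite /p ler_node// ki.
Qed.

Lemma cardinal_basisP : is_cardinal_basis e x (cardinal_basis e x).
Proof. by rewrite /cardinal_basis; apply: xgetPex exists_cardinal_basis. Qed.

(** No point of [x] lies inside a gap, so every section K(., x_j) obeys [bb_kernel_interp] there. By
    linearity so does the whole span, and a cardinal function is then determined by its values at
    the two ends. *)
Lemma cardinal_basis_interp (i : 'I_N) (m : 'I_N.+1) y :
  node x m <= y <= node x m.+1 ->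
  let p := node x m in let q := node x m.+1 in
  cardinal_basis e x i y
  = sinh (e * (q - y)) / sinh (e * (q - p)) * (i.+1 == m)%:R
  + sinh (e * (y - p)) / sinh (e * (q - p)) * (i.+1 == m.+1)%:R.
Proof.
move=> ymq p q; have [/(_ i) [c _ lE] /(_ i) lx] := cardinal_basisP.
rewrite -lE in lx *.
have mN := ltn_ord m.
have pq : p < q by rewrite ltr_node// leqnn.
(* The cardinal conditions extend to the boundary nodes 0 and [N.+1]: the kernel vanishes there, and
   [i.+1] equals neither index. *)
have lnode k : (k <= N.+1)%N ->
    \sum_(j < N) c j * K (node x k) (tnth x j) = (i.+1 == k)%:R.
  have tnth01 j : 0 <= tnth x j <= 1 by rewrite -node_tnth node01// ltnS ltnW.
  case: k => [|k] kN.
    rewrite big1// => j _; have /andP[? _] := tnth01 j.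
    by rewrite bb_kernelC bb_kernelx0 ?mulr0.
  move: kN; rewrite leq_eqVlt => /predU1P[[->]|kN].
    rewrite eqSS ltn_eqF// big1// => j _; have /andP[_ ?] := tnth01 j.
    by rewrite node_last bb_kernelC bb_kernelx1 ?mulr0.
  by rewrite (node_tnth x (Ordinal (kN : (k < N)%N))) lx.
rewrite -(lnode m) 1?ltnW// -lnode// !mulr_sumr -big_split/=.
apply: eq_bigr => j _; rewrite (bb_kernel_interp e0 pq ymq); first by ring.
by rewrite -node_tnth; apply: node_outside_gap => //; rewrite ltnS ltnW.
Qed.

Lemma power_function_gap (m : 'I_N.+1) y : node x m <= y <= node x m.+1 ->
  power_function e x y
  = Num.sqrt (sinh (e * (y - node x m)) * sinh (e * (node x m.+1 - y))
              / (e * sinh (e * gap x m))).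
Proof.
move=> ymq; have mN := ltn_ord m; have mN1 := ltnW mN.
have pq : node x m < node x m.+1 by rewrite ltr_node// leqnn.
have y01 : 0 <= y <= 1.
  have /andP[p0 _] := node01 hx mN1; have /andP[_ q1] := node01 hx mN.
  have /andP[py yq] := ymq.
  by rewrite (le_trans p0 py) (le_trans yq q1).
rewrite -(bb_kernel_interp_error e0 pq ymq) /power_function.
congr (Num.sqrt (_ - _)).
(* Writing the kernel at both ends as sums over the interior points treats inner and boundary gaps
   alike. *)
rewrite -!sum_kernel_node// !mulr_sumr -big_split/=.
by apply: eq_bigr => i _; rewrite (cardinal_basis_interp i ymq); ring.
Qed.

Lemma tanh_sinh_ratio g : 0 < g ->
  tanh (e * g / 2) / (2 * e) = sinh (e * g / 2) ^+ 2 / (e * sinh (e * g)).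
Proof.
move=> g0; have eg0 : 0 < e * g by exact: mulr_gt0.
have S0 := sinh_gt0 eg0.
transitivity (tanh (e * g / 2) / 2 / e); first by field; rewrite gt_eqF.
by rewrite -tanh_half//; field; rewrite !gt_eqF.
Qed.

Lemma power_function_le (m : 'I_N.+1) y : node x m <= y <= node x m.+1 ->
  power_function e x y <= Num.sqrt (tanh (e * gap x m / 2) / (2 * e)).
Proof.
move=> ymq; rewrite (power_function_gap ymq); apply: ler_wsqrtr.
have g0 := gap_gt0 hx m; rewrite tanh_sinh_ratio//.
have d0 : 0 < (e * sinh (e * gap x m))^-1.
  by rewrite invr_gt0; apply: mulr_gt0 => //; apply/sinh_gt0/mulr_gt0.
rewrite (ler_pM2r d0) sinhM_midpoint -mulrDr.
have -> : y - node x m + (node x m.+1 - y) = gap x m by rewrite /gap; ring.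
by rewrite gerBl sqr_ge0.
Qed.

Lemma power_function_midpoint (m : 'I_N.+1) :
  power_function e x ((node x m + node x m.+1) / 2)
  = Num.sqrt (tanh (e * gap x m / 2) / (2 * e)).
Proof.
have g0 := gap_gt0 hx m; rewrite tanh_sinh_ratio//.
rewrite (@power_function_gap m); last by rewrite /gap in g0; lra.
congr (Num.sqrt (_ / _)); rewrite expr2 /gap.
by congr (sinh _ * sinh _); lra.
Qed.

(** Continuity of the closed form on the gap spreads the midpoint value to an interval, as the
    essential supremum requires. *)
Lemma power_function_near_midpoint (m : 'I_N.+1) (c : R) :
  c < Num.sqrt (tanh (e * gap x m / 2) / (2 * e)) ->
  exists a b, [/\ node x m <= a, a < b, b <= node x m.+1 &
    forall y, a < y < b -> c < power_function e x y].
Proof.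
set p := node x m; set q := node x m.+1.
have pq : p < q by rewrite ltr_node// leqnn/=.
rewrite -power_function_midpoint -/p -/q; set mid := (p + q) / 2.
have pmid : p < mid by rewrite /mid; lra.
have midq : mid < q by rewrite /mid; lra.
rewrite (@power_function_gap m) -/p -/q; last by rewrite !ltW.
pose f y := Num.sqrt (sinh (e * (y - p)) * sinh (e * (q - y))
                      / (e * sinh (e * gap x m))).
rewrite -/(f mid) => cf.
have fmid : f y @[y --> mid] --> f mid.
  apply: (continuous_cvg _ (h := Num.sqrt)); first exact: sqrt_continuous.
  apply: cvgM; last exact: cvg_cst.
  apply: cvgM; (apply: (continuous_cvg _ (h := sinh)); first exact: continuous_sinh);
    (apply: cvgM; first exact: cvg_cst); apply: cvgB; solve [exact: cvg_cst | exact: cvg_id].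
have /nbhs_ballP[d /= d0 df] : \forall y \near mid, c < f y.
  exact: cvgr_gt _ fmid _ cf.
(* The right half of the ball is cut at [q], so that the interval stays in the gap where the closed
   form is valid. *)
exists mid, (Num.min q (mid + d)); split.
- exact: ltW.
- by rewrite lt_min midq ltrDl.
- by rewrite ge_min lexx.
move=> y; rewrite lt_min => /and3P[midy yq ymd].
rewrite (@power_function_gap m); last by rewrite (ltW (lt_trans pmid midy)) ltW.
apply: df; rewrite /ball/= distrC gtr0_norm ?subr_gt0//; lra.
Qed.

End cardinal.

(** * The norm as a maximum over gaps *)

Section sup_norm_of_power_function.
Context {R : realType} {N : nat}.
Variables (e : R) (x : N.-tuple R).
Hypotheses (e0 : 0 < e) (hx : point_set x).

Lemma exists_max_gap : exists i0 : 'I_N.+1, forall i, gap x i <= gap x i0.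
Proof.
exists [arg max_(i > ord0) gap x i]%O.
by case: arg_maxP => // i _ h j; apply: h.
Qed.

(** Nonnegativity at [i0] keeps the default value 0 of the big maximum from exceeding the attained
    one. *)
Lemma bigmax_attained (F : 'I_N.+1 -> R) i0 : 0 <= F i0 ->
  (forall i, F i <= F i0) -> \big[Num.max/0]_(i < N.+1) F i = F i0.
Proof.
move=> F0 Fle; apply/eqP; rewrite eq_le le_bigmax andbT.
by apply: bigmax_le.
Qed.

Lemma max_gap_eq :
  \big[Num.max/0]_(i < N.+1) Num.sqrt (tanh (e * gap x i / 2) / (2 * e))
  = Num.sqrt (tanh (e * fill_distance x) / (2 * e)).
Proof.
have [i0 gi0] := exists_max_gap.
rewrite /fill_distance (bigmax_attained (ltW (gap_gt0 hx i0)) gi0).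
rewrite (bigmax_attained (i0 := i0)) ?sqrtr_ge0//.
  by rewrite (mulrC 2^-1) mulrA.
move=> i; apply: ler_wsqrtr; rewrite ler_pM2r ?invr_gt0 ?mulr_gt0//.
by rewrite ler_tanh ler_pM2r ?invr_gt0// ler_pM2l.
Qed.

Lemma power_normE : power_norm e x
  = (\big[Num.max/0]_(i < N.+1)
       Num.sqrt (tanh (e * gap x i / 2) / (2 * e)))%:E.
Proof.
rewrite /power_norm; apply: Linf_norm01_eq => [y y01|c].
  rewrite sqrtr_ge0/=; have [i yi] := gap_locate x y01.
  apply: (le_trans (power_function_le e0 hx yi)).
  exact: (le_bigmax _ (fun i => Num.sqrt (tanh (e * gap x i / 2) / (2 * e)))).
have [i0 gi0] := exists_max_gap.
rewrite max_gap_eq /fill_distance (bigmax_attained (ltW (gap_gt0 hx i0)) gi0).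
rewrite (mulrC 2^-1) mulrA => /(power_function_near_midpoint e0 hx).
move=> [a [b [pa ab bq cP]]]; exists a, b; split => //.
  by apply: le_trans pa; have /andP[] := node01 hx (ltnW (ltn_ord i0)).
by apply: (le_trans bq); have /andP[] := node01 hx (ltn_ord i0).
Qed.

End sup_norm_of_power_function.

(** * Equally spaced points and the least fill distance *)

Section equispaced_points.
Context {R : realType} {N : nat}.
Implicit Types x : N.-tuple R.
Local Notation M := (N.+1%:R : R).

Lemma node_equispaced k : (k <= N.+1)%N ->
  node (equispaced N : N.-tuple R) k = k%:R / M.
Proof.
case: k => [|k]; first by rewrite mul0r.
rewrite leq_eqVlt => /predU1P[[->]|kN].
  by rewrite node_last divff// pnatr_eq0.
by rewrite (node_tnth _ (Ordinal (kN : (k < N)%N))) tnth_mktuple.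
Qed.

Lemma gap_equispaced i : gap (equispaced N : N.-tuple R) i = M^-1.
Proof.
have iN := ltn_ord i.
by rewrite /gap !node_equispaced// 1?ltnW// -mulrBl -natrB// subSnn mul1r.
Qed.

Lemma point_set_equispaced : point_set (equispaced N : N.-tuple R).
Proof.
have M0 : 0 < M by rewrite ltr0n.
split.
  apply/(sortedP 0) => i; rewrite size_tuple => iN.
  have nthE k (kN : (k < N)%N) :
      nth 0 (equispaced N : N.-tuple R) k = k.+1%:R / M.
    by rewrite (_ : k = Ordinal kN)// -tnth_nth tnth_mktuple.
  by rewrite !nthE// 1?ltnW// ltr_pM2r ?invr_gt0// ltr_nat.
apply/all_tnthP => i; rewrite tnth_mktuple divr_gt0 ?ltr0n//=.
by rewrite ltr_pdivrMr// mul1r ltr_nat ltnS.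
Qed.

Lemma fill_distance_equispaced :
  fill_distance (equispaced N : N.-tuple R) = (2 * M)^-1.
Proof.
rewrite /fill_distance (bigmax_attained (i0 := ord0)) ?gap_equispaced//.
- by rewrite invfM.
- by move=> i; rewrite gap_equispaced.
Qed.

Lemma gap_le_fill_distance x i : gap x i <= 2 * fill_distance x.
Proof.
rewrite /fill_distance mulrA mulfV ?mul1r ?pnatr_eq0//.
exact: (le_bigmax _ (gap x)).
Qed.

(** The [N.+1] gaps add up to 1, so the largest is at least their mean. *)
Lemma fill_distance_ge x : (2 * M)^-1 <= fill_distance x.
Proof.
have : \sum_(i < N.+1) gap x i <= \sum_(i < N.+1) 2 * fill_distance x.
  by apply: ler_sum => i _; exact: gap_le_fill_distance.
rewrite sum_gap sumr_const card_ord -[_ *+ _]mulr_natl => h.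
rewrite -[leLHS]mul1r ler_pdivrMr ?mulr_gt0 ?ltr0n//.
apply: (le_trans h); rewrite le_eqVlt; apply/orP; left; apply/eqP; ring.
Qed.

Lemma fill_distance_le_equispaced x :
  fill_distance x <= (2 * M)^-1 -> x = equispaced N.
Proof.
move=> hle.
have gle i : gap x i <= M^-1.
  apply: (le_trans (gap_le_fill_distance x i)).
  rewrite -(@ler_pM2l _ 2^-1) ?invr_gt0// mulrA mulVf ?pnatr_eq0// mul1r.
  by rewrite -invfM.
(* The differences [M^-1 - gap x i] are nonnegative and sum to 0, so each vanishes. *)
have gE i : gap x i = M^-1.
  apply/eqP; rewrite eq_sym -subr_eq0; apply/eqP; move: i isT.
  apply: (@psumr_eq0P _ _ predT) => [i _|]; first by rewrite subr_ge0.
  by rewrite sumrB sum_gap sumr_const card_ord -[_ *+ _]mulr_natl divff ?subrr//.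
have nodeE k : (k <= N.+1)%N -> node x k = k%:R / M.
  elim: k => [|k IH] kN; first by rewrite mul0r.
  have := gE (Ordinal kN); rewrite /gap /= => /eqP.
  by rewrite subr_eq IH 1?ltnW// => /eqP ->; rewrite -[in RHS]natr1 mulrDl mul1r addrC.
apply: eq_from_tnth => j.
by rewrite -node_tnth nodeE ?tnth_mktuple// ltnS ltnW.
Qed.

End equispaced_points.

(** * Minimizers and asymptotics of the norm *)

Section power_norm_and_fill_distance.
Context {R : realType}.
Variable e : R.
Hypothesis e0 : 0 < e.

Lemma power_norm_fill_distance N (x : N.-tuple R) : point_set x ->
  power_norm e x = (Num.sqrt (tanh (e * fill_distance x) / (2 * e)))%:E.
Proof. by move=> hx; rewrite power_normE// max_gap_eq. Qed.

(** The norm is a strictly increasing function of the fill distance, so both have the same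
    minimizers. *)
Lemma le_power_norm N (x y : N.-tuple R) : point_set x -> point_set y ->
  (power_norm e x <= power_norm e y)%E = (fill_distance x <= fill_distance y).
Proof.
move=> hx hy; rewrite !power_norm_fill_distance// lee_fin.
have fill_ge0 (z : N.-tuple R) : 0 <= fill_distance z.
  by apply: le_trans (fill_distance_ge z); rewrite invr_ge0 mulr_ge0.
have d0 : 0 < (2 * e)^-1 by rewrite invr_gt0 mulr_gt0.
have t0 (z : N.-tuple R) : 0 <= tanh (e * fill_distance z) / (2 * e).
  by apply: mulr_ge0 (ltW d0); apply: tanh_ge0; rewrite mulr_ge0 ?(ltW e0).
by rewrite ler_sqrt// (ler_pM2r d0) ler_tanh ler_pM2l.
Qed.

Lemma power_norm_equispaced N :
  power_norm e (equispaced N : N.-tuple R)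
  = (Num.sqrt (tanh (e / (2 * N.+1%:R)) / (2 * e)))%:E.
Proof.
rewrite power_norm_fill_distance; last exact: point_set_equispaced.
by rewrite fill_distance_equispaced.
Qed.

Lemma power_norm_minimizers N :
  [set x : N.-tuple R | point_set x /\
     forall y : N.-tuple R, point_set y -> (power_norm e x <= power_norm e y)%E]
  = [set equispaced N].
Proof.
apply/seteqP; split => [x [hx /(_ _ point_set_equispaced)]|_ ->] /=.
  rewrite le_power_norm ?fill_distance_equispaced//; last exact: point_set_equispaced.
  exact: fill_distance_le_equispaced.
have he : point_set (equispaced N : N.-tuple R) by exact: point_set_equispaced.
by split => // y hy; rewrite le_power_norm// fill_distance_equispaced fill_distance_ge.
Qed.

Lemma power_norm_asymptotics N (x : N.-tuple R) : point_set x ->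
  (`| power_norm e x - ((Num.sqrt 2)^-1 * fill_distance x `^ (1 / 2))%:E |
   <= (2 * (e * fill_distance x `^ (3 / 2)))%:E)%E.
Proof.
move=> hx; rewrite power_norm_fill_distance// -EFinB lee_fin.
apply: sqrt_tanh_sub => //.
by apply: le_trans (fill_distance_ge x); rewrite invr_ge0 mulr_ge0.
Qed.

Lemma power_norm_equispaced_asymptotics N :
  (`| power_norm e (equispaced N : N.-tuple R)
      - (2^-1 * N.+1%:R `^ (- (1 / 2)))%:E |
   <= (2 * (e * N.+1%:R `^ (- (3 / 2))))%:E)%E.
Proof.
have he : point_set (equispaced N : N.-tuple R) by exact: point_set_equispaced.
have := power_norm_asymptotics he; rewrite fill_distance_equispaced.
have inv_powR (m r : R) : 0 <= m -> (2 * m)^-1 `^ r = 2 `^ (- r) * m `^ (- r).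
  by move=> m0; rewrite invfM powRM ?invr_ge0// -!powR_inv1// -!powRrM !mulN1r.
rewrite !inv_powR//.
have -> : (Num.sqrt 2)^-1 * (2 `^ (- (1 / 2)) * N.+1%:R `^ (- (1 / 2)))
    = 2^-1 * N.+1%:R `^ (- (1 / 2)) :> R.
  by rewrite powRN div1r powR12_sqrt// mulrA -invfM -expr2 sqr_sqrtr.
(* The remaining factor 2^(-3/2) is at most 1, so the constant 2 is kept. *)
move=> /le_trans; apply; rewrite lee_fin ler_pM2l// ler_pM2l//.
by rewrite ler_piMl ?powR_ge0// -[leRHS](powRr0 2) ler_powR ?ler1n//; lra.
Qed.

End power_norm_and_fill_distance.


Theorem theorem5 (R : realType) :
  [/\ (forall (N : nat) (x : N.-tuple R) (eps : R), point_set x -> 0 < eps ->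
         power_norm eps x
           = (\big[Num.max/0]_(i < N.+1)
                Num.sqrt (tanh (eps * gap x i / 2) / (2 * eps)))%:E
         /\ \big[Num.max/0]_(i < N.+1)
                Num.sqrt (tanh (eps * gap x i / 2) / (2 * eps))
           = Num.sqrt (tanh (eps * fill_distance x) / (2 * eps))),
      (exists C : R,
         forall (N : nat) (x : N.-tuple R) (eps : R), point_set x -> 0 < eps ->
           (`| power_norm eps x
               - ((Num.sqrt 2)^-1 * fill_distance x `^ (1 / 2))%:E |
            <= (C * (eps * fill_distance x `^ (3 / 2)))%:E)%E),
      (forall (N : nat) (eps : R), 0 < eps ->
         [set x : N.-tuple R | point_set x /\
            forall y : N.-tuple R, point_set y ->
              (power_norm eps x <= power_norm eps y)%E]
           = [set equispaced N]
         /\ power_norm eps (equispaced N : N.-tuple R)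
           = (Num.sqrt (tanh (eps / (2 * N.+1%:R)) / (2 * eps)))%:E) &
      (exists C : R,
         forall (N : nat) (eps : R), 0 < eps ->
           (`| power_norm eps (equispaced N : N.-tuple R)
               - (2^-1 * N.+1%:R `^ (- (1 / 2)))%:E |
            <= (C * (eps * N.+1%:R `^ (- (3 / 2))))%:E)%E)].
Proof.
split.
- move=> N x e hx e0; split; first exact: power_normE.
  exact: max_gap_eq.
- by exists 2 => N x e hx e0; exact: power_norm_asymptotics.
- move=> N e e0; split; first exact: power_norm_minimizers.
  exact: power_norm_equispaced.
- by exists 2 => N e e0; exact: power_norm_equispaced_asymptotics.
Qed.
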